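(* Let $N\ge 2$ and let $g\colon\mathbb{R}\to\mathbb{R}$ satisfy all of the following: (a) $g$ is continuous and $g(0)=0$; (b) $\lim_{s\to 0}G_+(s)/|s|^2=0$ and $\limsup_{s\to 0}g_+(s)/s<\infty$; (c) if $N\ge 3$, then $\limsup_{|s|\to\infty}|g(s)|/|s|^{2^*-1}<\infty$; if $N=2$, then $\lim_{|s|\to\infty}g(s)/e^{\alpha s^2}=0$ for all $\alpha>4\pi$; (d) $\lim_{|s|\to\infty}G_+(s)/|s|^{2+4/N}=0$; (e) there exists $\xi_0\ne 0$ such that $G(\xi_0)>0$. Then $$\lim_{\rho\to\infty}\inf_{\mathcal{D}(\rho)}J=-\infty.$$
   Context: $2^*=\frac{2N}{N-2}$ if $N\ge3$. $G(s)=\int_0^s g(t)\,dt$. $G_+(s)=\int_0^s\max\{g(t),0\}\,dt$ if $s\ge0$ and $G_+(s)=\int_s^0\max\{-g(t),0\}\,dt$ if $s<0$; $g_+=G_+'$, and $G_-:=G_+-G\ge0$. $\mathcal{D}(\rho)=\{u\in H^1(\mathbb{R}^N):\int_{\mathbb{R}^N}|u|^2\,dx\le\rho^2\}$. $J\colon H^1(\mathbb{R}^N)\to\mathbb{R}\cup\{\infty\}$, $J(u)=\frac12\int_{\mathbb{R}^N}|\nabla u|^2\,dx-\int_{\mathbb{R}^N}G(u)\,dx$, where $\int G(u)=\int G_+(u)-\int G_-(u)$, the first integral being finite on $H^1(\mathbb{R}^N)$, and $J(u)=\infty$ if $\int G_-(u)=\infty$. *)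

(* Defs.v *)
From HB Require Import structures.
From mathcomp Require Import all_boot all_order all_algebra.
From mathcomp Require Import all_classical all_reals all_analysis.

Set Implicit Arguments.
Unset Strict Implicit.
Unset Printing Implicit Defensive.

Import Order.TTheory GRing.Theory Num.Theory.
Import numFieldNormedType.Exports.

Local Open Scope classical_set_scope.
Local Open Scope ring_scope.

Definition measure_rV_display : measure_display.
Proof. exact. Qed.

(* Product sigma-algebra of the Borel sets of R, as for n.-tuple in the library;
   it coincides with the Borel sigma-algebra of R^n. *)
Section measurable_rV.
Context {R : realType}.
Variable n : nat.

Let coors : 'I_n -> 'rV[R]_n -> measurableTypeR R := fun i x => x 0 i.

Let rV_set0 : g_sigma_preimage coors set0.
Proof. exact: sigma_algebra0. Qed.

Let rV_setC A : g_sigma_preimage coors A -> g_sigma_preimage coors (~` A).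
Proof. exact: sigma_algebraC. Qed.

Let rV_bigcup (F : _^nat) : (forall i, g_sigma_preimage coors (F i)) ->
  g_sigma_preimage coors (\bigcup_i (F i)).
Proof. exact: sigma_algebra_bigcup. Qed.

HB.instance Definition _ := @isMeasurable.Build measure_rV_display
  'rV[R]_n (g_sigma_preimage coors) rV_set0 rV_setC rV_bigcup.

End measurable_rV.


Lemma sigma_finite_measureP d (T : measurableType d) (R : realType)
    (mu : {measure set T -> \bar R}) : sigma_finite setT mu ->
  exists nu : {sigma_finite_measure set T -> \bar R},
    mu = nu :> (set T -> \bar R).
Proof.
case: mu => mu c sf.
pose mu' : {measure set T -> \bar R} := HB.pack mu c.
pose H := Measure_isSigmaFinite.Build d T R mu' sf.
pose nu : {sigma_finite_measure set T -> \bar R} := HB.pack mu c H.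
by exists nu.
Qed.

Section lebesgue_measure_rV.
Context {R : realType}.

Definition cons_rV n (p : measurableTypeR R * 'rV[R]_n) : 'rV[R]_n.+1 :=
  row_mx (const_mx p.1 : 'rV[R]_1) p.2.

Fixpoint lebesgue_rV n : set 'rV[R]_n -> \bar R :=
  match n with
  | 0 => \d_(0 : 'rV[R]_0)
  | m.+1 => pushforward (lebesgue_measure \x (@lebesgue_rV m))%E (@cons_rV m)
  end.
Arguments lebesgue_rV n : clear implicits.

Lemma cons_rV0 n (p : measurableTypeR R * 'rV[R]_n) : cons_rV p 0 ord0 = p.1.
Proof.
rewrite /cons_rV (_ : ord0 = lshift n (0 : 'I_1)); last exact/val_inj.
by rewrite (row_mxEl (const_mx p.1 : 'rV[R]_1)) mxE.
Qed.

Lemma cons_rV_lift n (p : measurableTypeR R * 'rV[R]_n) (i : 'I_n) :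
  cons_rV p 0 (lift ord0 i) = p.2 0 i.
Proof.
rewrite /cons_rV (_ : lift ord0 i = rshift 1 i); last exact/val_inj.
by rewrite (row_mxEr (const_mx p.1 : 'rV[R]_1)).
Qed.

Lemma measurable_coord_rV n (i : 'I_n) :
  measurable_fun [set: 'rV[R]_n] (fun x => x 0 i : measurableTypeR R).
Proof.
move=> _ A mA; apply: sub_sigma_algebra.
rewrite -bigcup_seq; exists i; first by rewrite /= mem_index_enum.
by exists A.
Qed.

Lemma measurable_cons_rV n : measurable_fun setT (@cons_rV n).
Proof.
apply: (@measurability _ _ _ _ setT _
  (\big[setU/set0]_(i < n.+1) preimage_set_system setT
     (fun x : 'rV[R]_n.+1 => x 0 i : measurableTypeR R) measurable)) => //.
move=> _ [B + <-]; rewrite -bigcup_seq => -[i _ [A mA <-]].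
rewrite !setTI -comp_preimage.
rewrite -[X in measurable X]setTI.
have [->|[j ->]] : i = ord0 \/ exists j, i = lift ord0 j.
  by case: (unliftP ord0 i) => [j ->|->]; [right; exists j|left].
- rewrite (_ : _ \o _ = fst); first exact: measurable_fst.
  by apply/funext => p /=; exact: cons_rV0.
- rewrite (_ : _ \o _ =
      (fun x : 'rV[R]_n => x 0 j : measurableTypeR R) \o snd).
    exact: (measurableT_comp (@measurable_coord_rV n j) measurable_snd).
  by apply/funext => p /=; exact: cons_rV_lift.
Qed.

Definition uncons_rV n (x : 'rV[R]_n.+1) : measurableTypeR R * 'rV[R]_n :=
  (x 0 ord0, \row_j x 0 (lift ord0 j)).

Lemma cons_rVK n : cancel (@cons_rV n) (@uncons_rV n).
Proof.
case=> a x; rewrite /uncons_rV cons_rV0; congr pair.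
by apply/rowP => j; rewrite mxE cons_rV_lift.
Qed.

Lemma measurable_fun_rV d (T : measurableType d) n (f : T -> 'rV[R]_n) :
  (forall i, measurable_fun setT (fun t => f t 0 i : measurableTypeR R)) ->
  measurable_fun setT f.
Proof.
move=> mf.
apply: (@measurability _ _ _ _ setT _
  (\big[setU/set0]_(i < n) preimage_set_system setT
     (fun x : 'rV[R]_n => x 0 i : measurableTypeR R) measurable)) => //.
move=> _ [B + <-]; rewrite -bigcup_seq => -[i _ [A mA <-]].
by rewrite !setTI -comp_preimage -[X in measurable X]setTI; exact: mf.
Qed.

Lemma measurable_uncons_rV n : measurable_fun setT (@uncons_rV n).
Proof.
apply/measurable_fun_pairP; split; first exact: measurable_coord_rV.
apply: measurable_fun_rV => i.
rewrite (_ : (fun _ => _) =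
  (fun x : 'rV[R]_n.+1 => x 0 (lift ord0 i) : measurableTypeR R)).
  exact: measurable_coord_rV.
by apply/funext => x /=; rewrite mxE.
Qed.

Lemma lebesgue_rV_structure n :
  exists mu : {sigma_finite_measure set 'rV[R]_n -> \bar R},
    lebesgue_rV n = mu :> (set 'rV[R]_n -> \bar R).
Proof.
elim: n => [|n [mu muE]]; first by exists \d_(0 : 'rV[R]_0).
have mc := @measurable_cons_rV n.
have sf : sigma_finite setT (lebesgue_rV n.+1).
  have /sigma_finiteP[A [TA ndA Aoo]] := sigma_finiteT
    (lebesgue_measure : {sigma_finite_measure set (measurableTypeR R) -> \bar R}).
  have /sigma_finiteP[B [TB ndB Boo]] := sigma_finiteT mu.
  exists (fun k => @uncons_rV n @^-1` (A k `*` B k)).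
    rewrite -preimage_bigcup (_ : \bigcup_k _ = setT) ?preimage_setT//.
    apply/seteqP; split=> // -[a x] _.
    have [k _ Aka] : (\bigcup_k A k) a by rewrite -TA.
    have [l _ Blx] : (\bigcup_k B k) x by rewrite -TB.
    exists (maxn k l) => //; split=> /=.
    - by move: a Aka; exact/subsetPset/ndA/leq_maxl.
    - by move: x Blx; exact/subsetPset/ndB/leq_maxr.
  move=> k; have [mA Afin] := Aoo k; have [mB Bfin] := Boo k; split.
    rewrite -[X in measurable X]setTI; apply: measurable_uncons_rV => //.
    exact: measurableX.
  rewrite /= muE /pushforward -comp_preimage.
  rewrite (_ : _ \o _ = id) ?preimage_id//; last first.
    by apply/funext => p; exact: cons_rVK.
  by rewrite product_measure1E// lte_mul_pinfty// ge0_fin_numE.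
have E : lebesgue_rV n.+1 = pushforward (lebesgue_measure \x mu)%E (@cons_rV n).
  by rewrite /= muE.
move: sf; rewrite E => sf.
pose nu : {measure set 'rV[R]_n.+1 -> \bar R} :=
  measure_function_pushforward__canonical__measure_function_Measure
    ((lebesgue_measure : {measure set (measurableTypeR R) -> \bar R}) \x mu)%E
    (@measurable_cons_rV n).
exact: (sigma_finite_measureP (mu := nu) sf).
Qed.

Let lebesgue_rV_set0 n : lebesgue_rV n set0 = 0%E.
Proof. by have [mu ->] := lebesgue_rV_structure n; exact: measure0. Qed.

Let lebesgue_rV_ge0 n A : (0 <= lebesgue_rV n A)%E.
Proof. by have [mu ->] := lebesgue_rV_structure n; exact: measure_ge0. Qed.

Let lebesgue_rV_sigma_additive n : semi_sigma_additive (lebesgue_rV n).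
Proof.
have [mu ->] := lebesgue_rV_structure n; exact: measure_semi_sigma_additive.
Qed.

Let lebesgue_rV_sigma_finite n : sigma_finite setT (lebesgue_rV n).
Proof. by have [mu ->] := lebesgue_rV_structure n; exact: sigma_finiteT. Qed.

HB.instance Definition _ n := isMeasure.Build _ _ _ (lebesgue_rV n)
  (@lebesgue_rV_set0 n) (@lebesgue_rV_ge0 n) (@lebesgue_rV_sigma_additive n).

HB.instance Definition _ n := Measure_isSigmaFinite.Build _ _ _
  (lebesgue_rV n) (@lebesgue_rV_sigma_finite n).

Lemma lebesgue_rV_box n (A : 'I_n -> set (measurableTypeR R)) :
  (forall i, measurable (A i)) ->
  (lebesgue_rV n [set x : 'rV[R]_n | forall i, A i (x 0%R i)] =
   \prod_(i < n) lebesgue_measure (A i))%E.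
Proof.
elim: n A => [|n IH] A mA.
  rewrite big_ord0 /= diracE (_ : _ \in _)//.
  by apply/mem_set => -[].
rewrite big_ord_recl /= /pushforward.
rewrite (_ : _ @^-1` _ = A ord0 `*`
    [set x : 'rV[R]_n | forall i, A (lift ord0 i) (x 0 i)]); last first.
  apply/seteqP; split=> p /=.
    move=> h; split; first by rewrite -cons_rV0; exact: h.
    by move=> i; rewrite -cons_rV_lift; exact: h.
  move=> [h0 h] i; case: (unliftP ord0 i) => [j ->|->].
    by rewrite cons_rV_lift; exact: h.
  by rewrite cons_rV0.
rewrite product_measure1E//; first by congr (_ * _)%E; exact: IH.
rewrite (_ : [set x | _] = \bigcap_(i in [set: 'I_n])
    ((fun x : 'rV[R]_n => x 0 i : measurableTypeR R) @^-1` A (lift ord0 i))).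
  apply: fin_bigcap_measurable => // i _.
  by rewrite -[X in measurable X]setTI; exact: measurable_coord_rV.
by apply/seteqP; split=> [x h i _|x h i]; [exact: h|exact: (h i I)].
Qed.

End lebesgue_measure_rV.
Arguments lebesgue_rV R n : clear implicits.

Section smooth.
Context {R : realType} {n : nat}.
Implicit Types f : 'rV[R]_n -> R.

Definition partial (i : 'I_n) f : 'rV[R]_n -> R :=
  fun x => 'D_(delta_mx 0 i) f x.

Fixpoint Ck (k : nat) f : Prop :=
  continuous f /\
  match k with
  | 0 => True
  | m.+1 => forall i : 'I_n,
      (forall x, derivable f x (delta_mx 0 i)) /\ Ck m (partial i f)
  end.

Definition test_function f : Prop :=
  (forall k, Ck k f) /\ compact (closure [set x | f x != 0]).

End smooth.

Section sobolev.
Context {R : realType} {n : nat}.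
Local Notation mu := (lebesgue_rV R n).
Implicit Types u v : 'rV[R]_n -> R.

Definition weak_partial (i : 'I_n) u v : Prop :=
  forall phi, test_function phi ->
    (\int[mu]_x (u x * partial i phi x)%:E = - \int[mu]_x (v x * phi x)%:E)%E.

(* An element of H^1(R^n) is represented by a representative of its class
   modulo equality almost everywhere, together with a representative of its
   weak gradient; the latter is determined by the former almost everywhere. *)
Record H1 := MkH1 {
  H1_fun :> 'rV[R]_n -> R ;
  H1_grad : 'I_n -> 'rV[R]_n -> R ;
  H1_fun_L2 : H1_fun \in Lfun mu 2%:E ;
  H1_grad_L2 : forall i, H1_grad i \in Lfun mu 2%:E ;
  H1_gradP : forall i, weak_partial i H1_fun (H1_grad i)
}.

End sobolev.
Arguments H1 R n : clear implicits.

Section nonlinearity.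
Context {R : realType}.
Implicit Type g : R -> R.
Local Notation lambda := (@lebesgue_measure R).

Definition G g (s : R) : R :=
  if 0 <= s then \int[lambda]_(t in `[0, s]) g t
  else - \int[lambda]_(t in `[s, 0]) g t.

Definition Gplus g (s : R) : R :=
  if 0 <= s then \int[lambda]_(t in `[0, s]) Num.max (g t) 0
  else \int[lambda]_(t in `[s, 0]) Num.max (- g t) 0.

Definition gplus g : R -> R := (Gplus g)^`()%classic.

Definition Gminus g (s : R) : R := Gplus g s - G g s.

(* The filter "|s| -> oo" on R. *)
Definition abs_pinfty : set_system R :=
  [set A | exists M : R, forall s, M < `|s| -> A s].

Global Instance abs_pinfty_filter : ProperFilter abs_pinfty.
Proof.
split; first by move=> [M /(_ (`|M| + 1))]; apply; rewrite ger0_norm ?addr_ge0//;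
  rewrite (le_lt_trans (ler_norm M))// ltrDl.
split.
- by exists 0.
- move=> A B [M hA] [N hB]; exists (Num.max M N) => s; rewrite gt_max.
  by move=> /andP[Ms Ns]; split; [exact: hA|exact: hB].
- by move=> A B AB [M hA]; exists M => s /hA; exact: AB.
Qed.

(* Sobolev exponent 2^*, meaningful for 3 <= n only. *)
Definition critical_exponent (n : nat) : R := 2 * n%:R / (n%:R - 2).

End nonlinearity.

Section functional.
Context {R : realType} {n : nat}.
Local Notation mu := (lebesgue_rV R n).
Local Open Scope ereal_scope.

Definition mass_ball (rho : R) : set (H1 R n) :=
  [set u | \int[mu]_x (`|u x| ^+ 2)%:E <= (rho ^+ 2)%:E].

Definition intG (g : R -> R) (u : H1 R n) : \bar R :=
  \int[mu]_x (Gplus g (u x))%:E - \int[mu]_x (Gminus g (u x))%:E.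

(* If the integral of Gplus g u is finite and that of Gminus g u is +oo,
   the extended-real arithmetic gives J g u = +oo. *)
Definition J (g : R -> R) (u : H1 R n) : \bar R :=
  (2^-1)%:E * \int[mu]_x (\sum_(i < n) H1_grad u i x ^+ 2)%:E - intG g u.

End functional.

(* Main.v *)
(* The tensor-product bump u_L(x) = xi0 * prod_i phi_L(x_i), where phi_L is a
   C^1 cutoff equal to 1 on [-L, L] and to 0 outside [-L-1, L+1], equals xi0 on
   the cube of half-side L, while its gradient and G(u_L) are bounded
   independently of L and, outside that cube, live on a layer of volume
   O(L^(N-1)). Hence
     J(u_L) <= C ((2L+2)^N - (2L)^N) - G(xi0) (2L)^N -> -oo,
   and each u_L belongs to D(rho) for rho large. The only analytic point is that
   the classical gradient of u_L is its weak gradient: by Fubini it reduces to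
   the vanishing of the integral of a compactly supported derivative along every
   line parallel to a coordinate axis. *)
Require Import Defs.
From mathcomp Require Import all_boot all_order all_algebra.
From mathcomp Require Import all_classical all_reals all_analysis.
From mathcomp Require Import measurable_realfun ring lra.

Set Implicit Arguments.
Unset Strict Implicit.
Unset Printing Implicit Defensive.

Import Order.TTheory GRing.Theory Num.Theory.
Import numFieldNormedType.Exports.

Local Open Scope classical_set_scope.
Local Open Scope ring_scope.

(** * Measurability of continuous functions on ['rV[R]_n] *)

(* f is the pointwise limit of its compositions with the roundings to the grids
   of step 1 / k.+1, which take countably many values. *)
Lemma continuous_measurable_rV (R : realType) n (f : 'rV[R]_n -> R) :
  continuous f -> measurable_fun [set: 'rV[R]_n] f.
Proof.
move=> cf.
pose q (k : nat) (x : 'rV[R]_n) : 'rV[int]_n :=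
  \row_i Num.floor (x 0 i * k.+1%:R).
pose r (k : nat) (z : 'rV[int]_n) : 'rV[R]_n := \row_i ((z 0 i)%:~R / k.+1%:R).
apply: (@measurable_fun_cvg _ _ _ _ (fun k x => f (r k (q k x)))).
  move=> k _ A mA; rewrite setTI.
  rewrite (_ : _ @^-1` A = \bigcup_z
      ([set x | q k x = z] `&` [set x | A (f (r k z))])); last first.
    apply/seteqP; split => x /=; first by move=> Ax; exists (q k x).
    by case=> z _ [/= <-].
  apply: countable_bigcupT_measurable; first exact: countableP.
  move=> z; apply: measurableI; last first.
    have [Az|Az] := pselect (A (f (r k z))).
      by rewrite (_ : [set x | _] = setT)//; apply/seteqP; split.
    by rewrite (_ : [set x | _] = set0)//; apply/seteqP; split.
  rewrite (_ : [set x | _] = \bigcap_(i in [set: 'I_n])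
      ((fun x : 'rV[R]_n => x 0 i : measurableTypeR R) @^-1`
        [set t | Num.floor (t * k.+1%:R) = z 0 i])); last first.
    apply/seteqP; split => x /=.
      by move=> <- i _ /=; rewrite mxE.
    by move=> h; apply/rowP => i; rewrite mxE; exact: h.
  apply: fin_bigcap_measurable => // i _.
  rewrite -[X in measurable X]setTI; apply: measurable_coord_rV => //.
  rewrite (_ : [set t | _] =
      `[(z 0 i)%:~R / k.+1%:R, ((z 0 i) + 1)%:~R / k.+1%:R[%classic);
    last first.
    apply/seteqP; split => t /=.
      move=> <-; rewrite in_itv/= ler_pdivrMr ?ltr_pdivlMr//.
      by rewrite floor_le floorD1_gt.
    rewrite in_itv/= ler_pdivrMr ?ltr_pdivlMr// => ht.
    exact: floor_def.
  exact: measurable_itv.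
move=> x _; apply: (@cvg_comp _ _ _ (fun k => r k (q k x)) f _ (nbhs x));
  last exact: cf.
apply/cvgrPdist_le => e e0.
near=> k; rewrite /Num.norm/= mx_normrE.
apply/bigmax_leP; split => [|[i j] _]; first exact: ltW.
rewrite !mxE/= (ord1 i).
have k0 : (0 : R) < k.+1%:R by [].
rewrite ger0_norm; last first.
  by rewrite subr_ge0 ler_pdivrMr// floor_le.
rewrite lerBlDl.
have /ltW := floorD1_gt (x 0 j * k.+1%:R).
rewrite -ler_pdivlMr// intrD mulrDl => /le_trans; apply.
rewrite lerD2l mul1r; apply: ltW; near: k.
exact: (near_infty_natSinv_lt (PosNum e0)).
Unshelve. all: end_near. Qed.

(** * Cubes, and Fubini for bounded functions supported in a cube *)

Definition box (R : realType) n (a : R) : set 'rV[R]_n :=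
  [set x | forall i, `|x 0 i| <= a].

Lemma boxE (R : realType) n (a : R) :
  @box R n a = [set x | forall i, `[- a, a]%classic (x 0 i)].
Proof.
by apply/seteqP; split => x h i; have := h i; rewrite /= in_itv/= -ler_norml.
Qed.

Lemma measurable_box (R : realType) n (a : R) : measurable (@box R n a).
Proof.
rewrite (_ : box _ = \bigcap_(i in [set: 'I_n])
    ((fun x : 'rV[R]_n => x 0 i : measurableTypeR R) @^-1` `[- a, a]%classic)).
  apply: fin_bigcap_measurable => // i _.
  by rewrite -[X in measurable X]setTI; apply: measurable_coord_rV.
by rewrite boxE; apply/seteqP; split => x h i; [move=> _; exact: h|exact: h].
Qed.

Lemma lebesgue_rV_cube (R : realType) n (a : R) : 0 <= a ->
  (lebesgue_rV R n : {measure set 'rV[R]_n -> \bar R}) (box a) =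
  ((2 * a) ^+ n)%:E.
Proof.
move=> a0; rewrite boxE /= (@lebesgue_rV_box R n (fun=> [set` `[- a, a]])).
  rewrite (eq_bigr (fun=> (2 * a)%:E)).
    by rewrite prodEFin prodr_const card_ord.
  move=> i _; rewrite lebesgue_measure_itv/= lte_fin.
  (* The length formula for an interval distinguishes whether [- a < a]; otherwise [a = 0] and both
     sides vanish. *)
  case: ltP => h; first by rewrite -EFinB opprK mulr_natl.
  by rewrite (_ : a = 0) ?mulr0//; lra.
by move=> i; exact: measurable_itv.
Qed.

(** For measurable functions this is enough for integrability, since cubes have finite measure;
    unlike continuity with compact support, it also covers indicators of cubes and compositions with
    merely measurable functions. *)
Definition bounded_box_supp (R : realType) n (f : 'rV[R]_n -> R) :=
  exists a C : R, [/\ 0 <= a, (forall x, `|f x| <= C) &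
    (forall x, ~ box a x -> f x = 0)].

Lemma integrable_bounded_box_supp (R : realType) n (f : 'rV[R]_n -> R) :
  measurable_fun setT f -> bounded_box_supp f ->
  (lebesgue_rV R n).-integrable setT (EFin \o f).
Proof.
move=> mf [a [C [a0 fC f0]]].
have mb := @measurable_box R n a.
apply: (eq_integrable measurableT ((EFin \o f) \_ (box a))).
  move=> x _; rewrite patchE; case: ifPn => //.
  by rewrite notin_setE => /f0 /= ->.
apply/(integrable_mkcond (EFin \o f) mb).
apply: measurable_bounded_integrable => //.
- by rewrite lebesgue_rV_cube// ltry.
- exact: measurable_funTS.
- exists C; split; first exact: num_real.
  by move=> y Cy x _; exact: le_trans (fC x) (ltW Cy).
Qed.

Lemma cons_rV_box (R : realType) n (a t : R) (y : 'rV[R]_n) :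
  box a (cons_rV (t, y)) <-> `|t| <= a /\ box a y.
Proof.
split.
  move=> h; split; first by have := h ord0; rewrite cons_rV0.
  by move=> i; have := h (lift ord0 i); rewrite cons_rV_lift.
case=> ta yb i; case: (unliftP ord0 i) => [j ->|->].
  by rewrite cons_rV_lift; exact: yb.
by rewrite cons_rV0.
Qed.

(** The measure in dimension [n.+1] is by definition the image of a product measure under [cons_rV].
    Pulling the integral back along this map reduces both formulas to Fubini on the product,
    integrability being pulled back in the same way. *)
Lemma integral_lebesgue_rV_Fubini (R : realType) n (f : 'rV[R]_n.+1 -> R) :
  measurable_fun setT f -> bounded_box_supp f ->
  (\int[lebesgue_rV R n.+1]_x (f x)%:E =
   \int[lebesgue_measure]_t \int[lebesgue_rV R n]_y
     (f (cons_rV (t, y)))%:E)%E /\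
  (\int[lebesgue_rV R n.+1]_x (f x)%:E =
   \int[lebesgue_rV R n]_y \int[lebesgue_measure]_t
     (f (cons_rV (t, y)))%:E)%E.
Proof.
move=> mf bf.
have mc := @measurable_cons_rV R n.
pose m1 : {sigma_finite_measure set (measurableTypeR R) -> \bar R} :=
  lebesgue_measure.
pose m2 : {sigma_finite_measure set 'rV[R]_n -> \bar R} := lebesgue_rV R n.
have E (h : 'rV[R]_n.+1 -> \bar R) : (\int[lebesgue_rV R n.+1]_x h x =
    \int[pushforward (m1 \x m2) (@cons_rV R n)]_x h x)%E by [].
have mEf : measurable_fun setT (EFin \o f) by exact/measurable_EFinP.
have mF : measurable_fun setT ((EFin \o f) \o @cons_rV R n).
  exact: (measurableT_comp mEf mc).
have iF : (m1 \x m2)%E.-integrable setT ((EFin \o f) \o @cons_rV R n).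
  have /integrableP[_] := integrable_bounded_box_supp mf bf.
  rewrite E (ge0_integral_pushforward mc (m1 \x m2)%E measurableT).
  - by move=> fi; apply/integrableP; split.
  - exact: measurableT_comp.
  - by move=> ? _; exact: abse_ge0.
rewrite E (integral_pushforward mc mEf iF measurableT).
split.
  by rewrite -(integral12_prod_meas1 iF).
by rewrite -(integral21_prod_meas1 iF).
Qed.

Definition set_coord (R : realType) n (i : 'I_n) (x : 'rV[R]_n) (t : R)
  : 'rV[R]_n := \row_j (if j == i then t else x 0 j).

(** Induction on the dimension. If [i] is the first coordinate, it is integrated innermost;
    otherwise the first coordinate is frozen and the induction hypothesis applies to each slice. *)
Lemma integral_lebesgue_rV_lines_eq0 (R : realType) n (i : 'I_n)
    (f : 'rV[R]_n -> R) :
  measurable_fun setT f -> bounded_box_supp f ->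
  (forall x, \int[lebesgue_measure]_t (f (set_coord i x t))%:E = 0)%E ->
  (\int[lebesgue_rV R n]_x (f x)%:E = 0)%E.
Proof.
elim: n i f => [[]//|n IH] i f mf bf f0.
have [E1 E2] := integral_lebesgue_rV_Fubini mf bf.
case: (unliftP ord0 i) => [j ij|i0].
  rewrite E1; apply: integral0_eq => t _.
  apply: (IH j (fun y => f (cons_rV (t, y)))).
  - exact: (measurableT_comp (measurableT_comp mf (@measurable_cons_rV R n))
      (pair1_measurable t)).
  - case: bf => a [C [a0 fC fo]]; exists a, C; split => //.
    by move=> y yb; apply: fo => /cons_rV_box[].
  - move=> y; rewrite -[RHS](f0 (cons_rV (t, y))); apply: eq_integral => s _.
    congr (EFin (f _)); apply/rowP => k; rewrite [RHS]mxE.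
    case: (unliftP ord0 k) => [l ->|->].
      rewrite ij (inj_eq (@lift_inj _ ord0)) !cons_rV_lift/= mxE//.
    by rewrite ij !cons_rV0.
rewrite E2; apply: integral0_eq => y _.
rewrite -[RHS](f0 (cons_rV (0, y))); apply: eq_integral => s _.
congr (EFin (f _)); apply/rowP => k; rewrite [RHS]mxE i0.
case: (unliftP ord0 k) => [l ->|->]; last by rewrite cons_rV0 eqxx.
by rewrite !cons_rV_lift.
Qed.

(** * A C^1 cutoff on the line *)

(** The difference quotient differs from [d] by at most [C * |h|]. This criterion handles the square
    of the positive part uniformly, including at its junction point 0. *)
Lemma is_derive_quadratic (R : realType) (f : R -> R) (x d C : R) :
  (forall h, `|f (x + h) - f x - d * h| <= C * h ^+ 2) -> is_derive x 1 f d.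
Proof.
move=> fC.
have C0 : 0 <= C by have := le_trans (normr_ge0 _) (fC 1); rewrite expr1n mulr1.
suff cv : h^-1 *: (f (h *: 1 + x) - f x) @[h --> (0:R)^'] --> d.
  by apply: DeriveDef; [apply/cvg_ex; exists d|exact: cvg_lim].
apply/cvgrPdist_le => e e0.
(* Dividing by [C + 1] rather than [C] avoids treating [C = 0] separately. *)
have C10 : 0 < C + 1 by rewrite ltr_wpDl.
near=> h.
have h0 : h != 0 by near: h; exact: nbhs_dnbhs_neq.
have hn : `|h| < e / (C + 1).
  near: h; apply: dnbhs0_lt; exact: divr_gt0.
rewrite distrC (_ : _ - d = h^-1 * (f (x + h) - f x - d * h)); last first.
  by rewrite /GRing.scale/= mulr1 [h + x]addrC; field.
rewrite normrM normfV ler_pdivrMl ?normr_gt0// (le_trans (fC h))//.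
rewrite -real_normK ?num_real// expr2 mulrCA ler_wpM2l//.
move: hn; rewrite ltr_pdivlMr// => /ltW; apply: le_trans.
by rewrite mulrC ler_wpM2l// lerDl.
Unshelve. all: end_near. Qed.

Definition pos (R : realType) (x : R) : R := Num.max 0 x.

Lemma posP (R : realType) (x : R) : pos x = 0 /\ x <= 0 \/ pos x = x /\ 0 <= x.
Proof.
by rewrite /pos; case: (leP 0 x) => h; [right|left; split=> //; exact: ltW].
Qed.

Lemma continuous_pos (R : realType) : continuous (@pos R).
Proof.
move=> x; rewrite (_ : @pos R = fun x => 2^-1 * (x + `|x|)).
  apply: cvgM; first exact: cvg_cst.
  by apply: cvgD; [exact: cvg_id|apply: cvg_norm; exact: cvg_id].
apply/funext => y; have [[-> y0]|[-> y0]] := posP y.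
  by rewrite ler0_norm//; lra.
by rewrite ger0_norm//; lra.
Qed.

(** In each of the four sign cases of [x] and [x + h], the remainder is at most [h ^+ 2]. *)
Lemma is_derive_pos2 (R : realType) (x : R) :
  is_derive x 1 (fun y => pos y ^+ 2) (2 * pos x).
Proof.
apply: (@is_derive_quadratic _ _ _ _ 1) => h; rewrite ler_norml.
by have [[-> ?]|[-> ?]] := posP x; have [[-> ?]|[-> ?]] := posP (x + h);
  apply/andP; split; nra.
Qed.

Section cutoff.
Context {R : realType} (L : R).
Hypothesis L0 : 0 <= L.

(* A C^1 formula in t: writing pos (`|t| - L) for the two inner terms, of which
   at most one is nonzero, would bring in the kink of `|t|. *)
Definition cutoff (t : R) : R :=
  pos (1 - pos (t - L) ^+ 2 - pos (- t - L) ^+ 2) ^+ 2.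

Definition dcutoff (t : R) : R :=
  4 * pos (1 - pos (t - L) ^+ 2 - pos (- t - L) ^+ 2) *
  (pos (- t - L) - pos (t - L)).

Lemma is_derive_cutoff (t : R) : is_derive t 1 cutoff (dcutoff t).
Proof.
have d1 : is_derive t 1 (fun t => pos (t - L) ^+ 2) (2 * pos (t - L)).
  apply: (is_derive_eq (is_derive1_comp (is_derive_pos2 _) _)).
  by rewrite subr0 mulr1.
have d2 : is_derive t 1 (fun t => pos (- t - L) ^+ 2) (- (2 * pos (- t - L))).
  apply: (is_derive_eq (is_derive1_comp (is_derive_pos2 _) _)).
  by rewrite subr0 mulrN1.
apply: (is_derive_eq (is_derive1_comp (is_derive_pos2 _) _)).
by rewrite /dcutoff; ring.
Qed.

Lemma continuous_cutoff : continuous cutoff.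
Proof.
move=> t; apply/differentiable_continuous/derivable1_diffP.
exact: (@ex_derive _ _ _ _ _ _ _ (is_derive_cutoff t)).
Qed.

Lemma continuous_dcutoff : continuous dcutoff.
Proof.
have c1 : continuous (fun t => pos (t - L)).
  move=> t; apply: (@continuous_comp _ _ _ (fun t => t - L));
    last exact: continuous_pos.
  by apply: cvgB; [exact: cvg_id|exact: cvg_cst].
have c2 : continuous (fun t => pos (- t - L)).
  move=> t; apply: (@continuous_comp _ _ _ (fun t => - t - L));
    last exact: continuous_pos.
  by apply: cvgB; [apply: cvgN; exact: cvg_id|exact: cvg_cst].
move=> t; apply: cvgM; last by apply: cvgB; [exact: c2|exact: c1].
apply: cvgM; first exact: cvg_cst.
apply: (@continuous_comp _ _ _
    (fun t => 1 - pos (t - L) ^+ 2 - pos (- t - L) ^+ 2));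
  last exact: continuous_pos.
apply: cvgB; last first.
  exact: (continuous_comp (c2 t) (@exprn_continuous _ 2 _)).
apply: cvgB; first exact: cvg_cst.
exact: (continuous_comp (c1 t) (@exprn_continuous _ 2 _)).
Qed.

Let posE t : `|t| <= L -> pos (t - L) = 0 /\ pos (- t - L) = 0.
Proof.
rewrite ler_norml => /andP[? ?].
by split; [have [[-> _]|[-> ?]] := posP (t - L)|
  have [[-> _]|[-> ?]] := posP (- t - L)] => //; lra.
Qed.

Lemma cutoff1 t : `|t| <= L -> cutoff t = 1.
Proof.
move=> /posE[]; rewrite /cutoff => -> ->; rewrite expr0n/= !subr0.
by have [[_ ?]|[-> _]] := posP (1 : R); [lra|rewrite expr1n].
Qed.

Lemma dcutoff_in t : `|t| <= L -> dcutoff t = 0.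
Proof. by move=> /posE[]; rewrite /dcutoff => -> ->; rewrite subr0 mulr0. Qed.

(** One of the two inner positive parts is at least 1 there, so the outer argument is
    nonpositive. *)
Let pos_out t : L + 1 <= `|t| ->
  pos (1 - pos (t - L) ^+ 2 - pos (- t - L) ^+ 2) = 0.
Proof.
move=> h.
have [[-> //]|[-> H]] := posP (1 - pos (t - L) ^+ 2 - pos (- t - L) ^+ 2).
have [t0|t0] := leP 0 t.
  move: h H; rewrite ger0_norm//.
  by have [[-> ?]|[-> ?]] := posP (t - L);
    have [[-> ?]|[-> ?]] := posP (- t - L); nra.
move: h H; rewrite ltr0_norm//.
by have [[-> ?]|[-> ?]] := posP (t - L);
  have [[-> ?]|[-> ?]] := posP (- t - L); nra.
Qed.

Lemma cutoff0 t : L + 1 <= `|t| -> cutoff t = 0.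
Proof. by move=> /pos_out; rewrite /cutoff => ->; rewrite expr0n. Qed.

Lemma dcutoff0 t : L + 1 <= `|t| -> dcutoff t = 0.
Proof. by move=> /pos_out; rewrite /dcutoff => ->; rewrite mulr0 mul0r. Qed.

Lemma cutoff_ge0 t : 0 <= cutoff t.
Proof. exact: sqr_ge0. Qed.

Lemma cutoff_le1 t : cutoff t <= 1.
Proof.
rewrite /cutoff; set a := pos (t - L); set b := pos (- t - L).
by have [[-> ?]|[-> ?]] := posP (1 - a ^+ 2 - b ^+ 2); nra.
Qed.

(** With [a], [b] the inner positive parts, a nonzero outer factor forces a^2 + b^2 <= 1. Then both
    [b - a] and the outer factor have modulus at most 1, whatever [L] is. *)
Lemma dcutoff_le t : `|dcutoff t| <= 4.
Proof.
rewrite ler_norml /dcutoff.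
have a0 : 0 <= pos (t - L) by have [[-> ?]|[-> ?]] := posP (t - L).
have b0 : 0 <= pos (- t - L) by have [[-> ?]|[-> ?]] := posP (- t - L).
move: a0 b0; set a := pos (t - L); set b := pos (- t - L) => a0 b0.
have [[-> ?]|[-> ?]] := posP (1 - a ^+ 2 - b ^+ 2).
  by rewrite mulr0 mul0r; lra.
have a1 : a <= 1 by nra.
have b1 : b <= 1 by nra.
have : `|b - a| <= 1 by rewrite ler_norml; apply/andP; split; lra.
have : 0 <= 1 - a ^+ 2 - b ^+ 2 <= 1 by apply/andP; split; nra.
rewrite ler_norml; set u := 1 - _ - _; set v := b - a.
by move=> /andP[? ?] /andP[? ?]; apply/andP; split; nra.
Qed.

End cutoff.

(** * Products with continuous functions and calculus along coordinate lines *)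

Lemma bounded_box_suppD (R : realType) n (f h : 'rV[R]_n -> R) :
  bounded_box_supp f -> bounded_box_supp h ->
  bounded_box_supp (fun x => f x + h x).
Proof.
move=> [a [C [a0 fC f0]]] [b [D [b0 hD h0]]].
exists (Num.max a b), (C + D); split.
- by rewrite le_max a0.
- by move=> x; apply: le_trans (ler_normD _ _) _; exact: lerD.
- move=> x xab; rewrite f0 ?h0 ?addr0// => xb; apply: xab => i;
    by rewrite le_max xb ?orbT.
Qed.

Lemma compact_box (R : realType) n (a : R) : compact (@box R n a).
Proof.
rewrite boxE; apply: (@rV_compact R n (fun=> `[- a, a]%classic)) => i.
exact: segment_compact.
Qed.

(** A continuous [h] is bounded on the compact cube carrying [f], and off this cube the product
    vanishes. *)
Lemma bounded_box_suppM (R : realType) n (f h : 'rV[R]_n -> R) :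
  bounded_box_supp f -> continuous h ->
  bounded_box_supp (fun x => f x * h x).
Proof.
move=> [a [C [a0 fC f0]]] ch.
have [D [_ hD]] : bounded_set (h @` box a).
  apply: compact_bounded; apply: continuous_compact; last exact: compact_box.
  exact: continuous_subspaceT.
exists a, (C * (`|D| + 1)); split => //.
- move=> x; have [xa|/f0 ->] := pselect (box a x).
    rewrite normrM ler_pM//; apply: hD; last by exists x.
    by rewrite (le_lt_trans (ler_norm _))// ltrDl.
  by rewrite mul0r normr0 mulr_ge0// (le_trans _ (fC x)).
- by move=> x /f0 ->; rewrite mul0r.
Qed.

Lemma continuous_set_coord (R : realType) n (i : 'I_n) (x : 'rV[R]_n) :
  continuous (set_coord i x).
Proof.
move=> t; apply/cvgrPdist_le => e e0; near=> s.
rewrite /Num.norm/= mx_normrE; apply/bigmax_leP; split => [|[k j] _].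
  exact: ltW.
rewrite !mxE/=; case: eqP => _; last by rewrite subrr normr0 ltW.
by near: s; apply: (@cvgr_dist_le _ _ _ (nbhs t) _ id t).
Unshelve. all: end_near. Qed.

(** Moving [t] by [h] in [set_coord i x t] adds [h] times the i-th basis vector, so the two
    difference quotients are the same function of [h]. *)
Lemma is_derive_set_coord (R : realType) n (i : 'I_n) (x : 'rV[R]_n)
    (f : 'rV[R]_n -> R) :
  (forall y, derivable f y (delta_mx 0 i)) ->
  forall t : R, is_derive t (1 : R) (fun t : R => f (set_coord i x t))
    (partial i f (set_coord i x t)).
Proof.
move=> df t.
have E : (fun h : R => h^-1 *: (f (h *: delta_mx 0 i + set_coord i x t) -
    f (set_coord i x t))) = (fun h : R => h^-1 *:
    (f (set_coord i x (h *: 1 + t)) - f (set_coord i x t))).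
  apply/funext => h; congr (_ *: (f _ - _)); apply/rowP => j; rewrite !mxE/=.
  by case: eqP => _; rewrite /GRing.scale/= ?mulr1// mulr0 add0r.
have := df (set_coord i x t); rewrite /derivable E => cv.
by apply: DeriveDef => //; rewrite /partial /derive E.
Qed.

(** The integral reduces to [[- a, a]], where the fundamental theorem of calculus gives
    [F a - F (- a)]. *)
Lemma integral_derive_eq0 (R : realType) (f F : R -> R) (a : R) :
  0 < a -> continuous f -> (forall t, a <= `|t| -> f t = 0) ->
  (forall t : R, is_derive t (1 : R) F (f t)) -> F (- a) = F a ->
  (\int[lebesgue_measure]_t (f t)%:E = 0)%E.
Proof.
move=> a0 cf f0 dF Fa.
have cF : continuous F.
  move=> t; apply/differentiable_continuous/derivable1_diffP.
  exact: (@ex_derive _ _ _ _ _ _ _ (dF t)).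
have E : (\int[lebesgue_measure]_(t in `[(- a)%R, a]) (f t)%:E = 0)%E.
  rewrite (@continuous_FTC2 _ f F (- a) a).
  - by rewrite Fa subee.
  - by lra.
  - exact: continuous_subspaceT.
  - split; first by move=> t _; exact: (@ex_derive _ _ _ _ _ _ _ (dF t)).
    + by apply: cvg_at_right_filter; exact: cF.
    + by apply: cvg_at_left_filter; exact: cF.
  - by move=> t _; rewrite derive1E; exact: (@derive_val _ _ _ _ _ _ _ (dF t)).
rewrite -[RHS]E [RHS]integral_mkcond; apply: eq_integral => t _.
rewrite patchE; case: ifPn => //; rewrite notin_setE/= in_itv/= -ler_norml.
by move=> /negP; rewrite -ltNge => /ltW /f0 ->.
Qed.

(** * The tensor-product bump and its weak gradient *)

Section bump.
Context {R : realType} (n : nat) (L c : R).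
Hypothesis L0 : 0 <= L.
Implicit Types (x : 'rV[R]_n) (i : 'I_n).

Definition bump x : R := c * \prod_i cutoff L (x 0 i).

Definition dbump i x : R :=
  c * dcutoff L (x 0 i) * \prod_(j | j != i) cutoff L (x 0 j).

Lemma measurable_bump : measurable_fun setT bump.
Proof.
apply: measurable_funM => //; apply: measurable_prod => i _.
apply: (measurableT_comp _ (@measurable_coord_rV R n i)).
exact: continuous_measurable_fun (@continuous_cutoff R L).
Qed.

Lemma measurable_dbump i : measurable_fun setT (dbump i).
Proof.
apply: measurable_funM.
  apply: measurable_funM => //.
  apply: (measurableT_comp _ (@measurable_coord_rV R n i)).
  exact: continuous_measurable_fun (@continuous_dcutoff R L).
rewrite (_ : (fun _ => _) = (fun x : 'rV[R]_n =>
    \prod_j if j != i then cutoff L (x 0 j) else 1)); last first.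
  by apply/funext => x; rewrite big_mkcond.
apply: measurable_prod => j _; case: (j != i) => //.
apply: (measurableT_comp _ (@measurable_coord_rV R n j)).
exact: continuous_measurable_fun (@continuous_cutoff R L).
Qed.

Lemma prod_cutoff_itv (P : pred 'I_n) x :
  0 <= \prod_(j | P j) cutoff L (x 0 j) <= 1.
Proof.
apply/andP; split; first by apply: prodr_ge0 => j _; exact: cutoff_ge0.
by apply: prodr_ile1 => j _; rewrite cutoff_ge0 cutoff_le1.
Qed.

Lemma not_box x : ~ box (L + 1) x -> exists i, L + 1 <= `|x 0 i|.
Proof. by move=> /existsNP[i /negP]; rewrite -ltNge => /ltW; exists i. Qed.

Lemma bump0 x : ~ box (L + 1) x -> bump x = 0.
Proof.
by move=> /not_box[i xi]; rewrite /bump (bigD1 i)//= cutoff0// mul0r mulr0.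
Qed.

Lemma dbump0 i x : ~ box (L + 1) x -> dbump i x = 0.
Proof.
move=> /not_box[j xj]; rewrite /dbump; have [ji|ji] := eqVneq j i.
  by rewrite -ji dcutoff0// mulr0 mul0r.
by rewrite (bigD1 j)//= cutoff0// mul0r mulr0.
Qed.

Lemma bump_in x : box L x -> bump x = c.
Proof. by move=> xL; rewrite /bump big1 ?mulr1// => i _; rewrite cutoff1. Qed.

Lemma dbump_in i x : box L x -> dbump i x = 0.
Proof. by move=> xL; rewrite /dbump dcutoff_in// mulr0 mul0r. Qed.

Lemma dbump_le i x : `|dbump i x| <= 4 * `|c|.
Proof.
have /andP[? ?] := prod_cutoff_itv (fun j => j != i) x.
rewrite /dbump normrM (normrM c) (ger0_norm (x := \prod_(_ | _) _))//.
apply: (@le_trans _ _ (`|c| * `|dcutoff L (x 0 i)|)).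
  by rewrite ler_piMr// mulr_ge0.
by rewrite mulrC ler_wpM2r// dcutoff_le.
Qed.

Lemma bump_le x : `|bump x| <= `|c|.
Proof.
rewrite /bump normrM; have /andP[? ?] := prod_cutoff_itv xpredT x.
by rewrite (ger0_norm (x := \prod_(_ | _) _))// ler_piMr.
Qed.

Lemma bounded_box_supp_bump : bounded_box_supp bump.
Proof.
exists (L + 1), `|c|; split; first exact: addr_ge0.
- exact: bump_le.
- exact: bump0.
Qed.

Lemma bounded_box_supp_dbump i : bounded_box_supp (dbump i).
Proof.
exists (L + 1), (4 * `|c|); split; first exact: addr_ge0.
- exact: dbump_le.
- exact: dbump0.
Qed.

(** The sum of the two integrands is, on each line in direction [i], the derivative of [bump * phi],
    which vanishes at both ends of the support. Hence its integral is zero line by line, then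
    globally. *)
Lemma weak_partial_bump i : weak_partial i bump (dbump i).
Proof.
move=> phi [/(_ 1%N)[cphi /(_ i)[dphi [cdphi _]]] _].
have mphi := continuous_measurable_rV cphi.
have mdphi := continuous_measurable_rV cdphi.
have mA : measurable_fun setT (fun x => bump x * partial i phi x).
  by apply: measurable_funM => //; exact: measurable_bump.
have mB : measurable_fun setT (fun x => dbump i x * phi x).
  by apply: measurable_funM => //; exact: measurable_dbump.
have bA := bounded_box_suppM bounded_box_supp_bump cdphi.
have bB := bounded_box_suppM (bounded_box_supp_dbump i) cphi.
have iA := integrable_bounded_box_supp mA bA.
have iB := integrable_bounded_box_supp mB bB.
have : (\int[lebesgue_rV R n]_x
    (bump x * partial i phi x + dbump i x * phi x)%:E = 0)%E.
  apply: (@integral_lebesgue_rV_lines_eq0 _ _ i).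
  - exact: measurable_funD.
  - exact: bounded_box_suppD.
  (* [K] gathers the factors of the bump that are constant on the line through [x] in direction
     [i]. *)
  move=> x; pose K := c * \prod_(j | j != i) cutoff L (x 0 j).
  have prodE t : \prod_(j | j != i) cutoff L (set_coord i x t 0 j) =
      \prod_(j | j != i) cutoff L (x 0 j).
    by apply: eq_bigr => j /negbTE ji; rewrite mxE ji.
  pose P t := phi (set_coord i x t).
  pose D t := partial i phi (set_coord i x t).
  under eq_integral => t _.
    rewrite (_ : _ + _ = K * (cutoff L t * D t + dcutoff L t * P t));
      last first.
      rewrite /bump /dbump (bigD1 i)//= prodE mxE eqxx /K /P /D.
      by ring.
    over.
  have cP : continuous P.
    move=> t; apply: continuous_comp; last exact: cphi.
    exact: continuous_set_coord.
  have cD : continuous D.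
    move=> t; apply: continuous_comp; last exact: cdphi.
    exact: continuous_set_coord.
  apply: (@integral_derive_eq0 _ _ (fun t => K * (cutoff L t * P t)) (L + 1)).
  - exact: ltr_wpDl.
  - move=> t; apply: cvgM; first exact: cvg_cst.
    apply: cvgD; apply: cvgM; [exact: continuous_cutoff|exact: cD|
      exact: continuous_dcutoff|exact: cP].
  - by move=> t tL; rewrite cutoff0// dcutoff0// !mul0r addr0 mulr0.
  - move=> t; have d1 := is_derive_cutoff L t.
    have d2 : is_derive t (1 : R) P (D t) by exact: is_derive_set_coord.
    apply: (is_derive_eq (is_deriveM (is_derive_cst K _ _) (is_deriveM d1 d2))).
    by rewrite /GRing.scale/=; ring.
  - by rewrite !cutoff0 ?normrN ?(ler_norm (L + 1))// !mul0r.
rewrite (_ : (fun _ => _) = (fun x => (bump x * partial i phi x)%:E +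
   (dbump i x * phi x)%:E)%E); last by apply/funext => x; rewrite EFinD.
rewrite integralD//.
(* Finiteness of both integrals allows one of them to be moved to the other side in the extended
   reals. *)
have := integrable_fin_num measurableT iA.
have := integrable_fin_num measurableT iB.
rewrite /comp => /fineK <- /fineK <-.
by rewrite -EFinD -EFinN => -[/eqP]; rewrite addr_eq0 => /eqP ->.
Qed.

End bump.

(** * Measurability and local bounds for [G] and [Gplus] *)

(** What is needed of [T] to integrate [T \o u] when [u] takes values in [[- b, b]]; it will be used
    with [b] the modulus of the bump height. *)
Definition tame (R : realType) (b : R) (T : R -> R) :=
  measurable_fun `[- b, b] T /\ exists K, forall s, `|s| <= b -> `|T s| <= K.

Lemma tameB (R : realType) (b : R) (S T : R -> R) :
  tame b S -> tame b T -> tame b (fun s => S s - T s).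
Proof.
move=> [mS [K SK]] [mT [M TM]]; split; first exact: measurable_funB.
exists (K + M) => s sb; apply: le_trans (ler_normB _ _) _.
by apply: lerD; [exact: SK|exact: TM].
Qed.

Lemma tame_cst (R : realType) (b c : R) : tame b (fun=> c).
Proof. by split=> //; exists `|c|. Qed.

Lemma tame_if_ge0 (R : realType) (b : R) (S T : R -> R) :
  tame b S -> tame b T -> tame b (fun s => if 0 <= s then S s else T s).
Proof.
move=> [mS [K SK]] [mT [M TM]]; split.
  apply: measurable_fun_if => //.
  - exact: measurable_fun_ler.
  - by apply: measurable_funS mS => // ? [].
  - by apply: measurable_funS mT => // ? [].
exists (Num.max K M) => s sb; rewrite le_max.
by case: ifP => _; [rewrite SK|rewrite TM// orbT].
Qed.

(** [F] is the integral from [- b]. A single base point left of all arguments serves both signs of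
    [s], and [F] is bounded because it is continuous on a compact interval. *)
Lemma tame_primitive (R : realType) (b : R) (h : R -> R) :
  0 <= b -> continuous h -> exists F, [/\ tame b F,
    forall s, 0 <= s <= b ->
      \int[lebesgue_measure]_(t in `[0, s]) h t = F s - F 0 &
    forall s, - b <= s <= 0 ->
      \int[lebesgue_measure]_(t in `[s, 0]) h t = F 0 - F s].
Proof.
move=> b0 ch.
have ih x y : lebesgue_measure.-integrable `[x, y] (EFin \o h).
  apply: continuous_compact_integrable; first exact: segment_compact.
  exact: continuous_subspaceT.
pose F s := \int[lebesgue_measure]_(t in `[- b, s]) h t.
have FB s t : - b <= s -> s <= t ->
    \int[lebesgue_measure]_(t in `[s, t]) h t = F t - F s.
  move=> bs st; rewrite /F Rintegral_itvB//.
  rewrite -Rintegral_itv_obnd_cbnd//.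
  by apply: integrableS (ih s t) => //; exact: subset_itv_oc_cc.
exists F; split.
- have cF : {within `[- b, b], continuous F}.
    by apply: parameterized_integral_continuous => //; lra.
  split; first exact: subspace_continuous_measurable_fun.
  have [D [_ hD]] : bounded_set (F @` `[- b, b]).
    apply: compact_bounded; apply: continuous_compact => //.
    exact: segment_compact.
  exists (`|D| + 1) => s sb; apply: hD.
    by rewrite (le_lt_trans (ler_norm _))// ltrDl.
  by exists s => //=; rewrite in_itv/= -ler_norml.
- by move=> s /andP[? ?]; apply: FB => //; lra.
- by move=> s /andP[? ?]; apply: FB.
Qed.

Lemma eq_tame (R : realType) (b : R) (S T : R -> R) :
  (forall s, `|s| <= b -> S s = T s) -> tame b S -> tame b T.
Proof.
move=> ST [mS [K SK]]; split.
  apply: eq_measurable_fun mS => s /set_mem/=.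
  by rewrite in_itv/= -ler_norml => /ST.
by exists K => s sb; rewrite -ST// SK.
Qed.

Lemma tame_G (R : realType) (b : R) (g : R -> R) :
  0 <= b -> continuous g -> tame b (G g).
Proof.
move=> b0 cg; have [F [tF F1 F2]] := tame_primitive b0 cg.
apply: (@eq_tame _ _ (fun s => F s - F 0)).
  move=> s; rewrite /G ler_norml => /andP[? ?]; case: ifPn => [s0|].
    by rewrite F1// s0.
  by rewrite -ltNge => /ltW s0; rewrite F2 ?opprB//; apply/andP.
by apply: tameB => //; exact: tame_cst.
Qed.

(** The integrand defining [Gplus] changes with the sign of [s], so two primitives are glued at
    0. *)
Lemma tame_Gplus (R : realType) (b : R) (g : R -> R) :
  0 <= b -> continuous g -> tame b (Gplus g).
Proof.
move=> b0 cg.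
have c1 : continuous (fun t => Num.max (g t) 0).
  move=> t; rewrite (_ : (fun _ => _) = @pos R \o g).
    by apply: continuous_comp; [exact: cg|exact: continuous_pos].
  by apply/funext => s; rewrite /pos/= maxC.
have c2 : continuous (fun t => Num.max (- g t) 0).
  move=> t; rewrite (_ : (fun _ => _) = @pos R \o (fun t => - g t)).
    by apply: continuous_comp; [apply: cvgN; exact: cg|exact: continuous_pos].
  by apply/funext => s; rewrite /pos/= maxC.
have [F [tF F1 _]] := tame_primitive b0 c1.
have [H [tH _ H2]] := tame_primitive b0 c2.
apply: (@eq_tame _ _ (fun s => if 0 <= s then F s - F 0 else H 0 - H s)).
  move=> s; rewrite /Gplus ler_norml => /andP[? ?]; case: ifPn => [s0|].
    by rewrite F1// s0.
  by rewrite -ltNge => /ltW s0; rewrite H2//; apply/andP.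
by apply: tame_if_ge0; apply: tameB => //; exact: tame_cst.
Qed.

Lemma G0 (R : realType) (g : R -> R) : G g 0 = 0.
Proof. by rewrite /G lexx set_itv1 Rintegral_set1. Qed.

Lemma Gplus0 (R : realType) (g : R -> R) : Gplus g 0 = 0.
Proof. by rewrite /Gplus lexx set_itv1 Rintegral_set1. Qed.

(** The condition [T 0 = 0] is what keeps the support of [T \o u] inside the cube carrying [u]. *)
Lemma tame_comp (R : realType) n (b : R) (T : R -> R) (u : 'rV[R]_n -> R) :
  tame b T -> T 0 = 0 -> (forall x, `|u x| <= b) ->
  measurable_fun setT u -> bounded_box_supp u ->
  measurable_fun setT (T \o u) /\ bounded_box_supp (T \o u).
Proof.
move=> [mT [K TK]] T0 ub mu [a [C [a0 _ u0]]]; split.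
  apply: (@measurable_comp _ _ _ _ _ _ `[- b, b]%classic) => //.
  by move=> _ [x _ <-] /=; rewrite in_itv/= -ler_norml.
exists a, K; split=> //; first by move=> x; exact: TK.
by move=> x /u0 /= ->.
Qed.

(** * The bump as an element of [H1] and the upper bound on [J] *)

Lemma Lfun2_bounded_box_supp (R : realType) n (f : 'rV[R]_n -> R) :
  measurable_fun setT f -> bounded_box_supp f ->
  f \in Lfun (lebesgue_rV R n) 2%:E.
Proof.
move=> mf [a [C [a0 fC f0]]]; rewrite inE/=; apply/andP; split; rewrite inE//=.
rewrite /finite_norm unlock; apply: poweR_lty.
have /integrableP[_] : (lebesgue_rV R n).-integrable setT
    (EFin \o (fun x => `|f x| ^+ 2)).
  apply: integrable_bounded_box_supp.
    by apply: measurable_funX; exact: measurableT_comp.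
  exists a, (C ^+ 2); split => //.
    by move=> x; rewrite normrX normr_id lerXn2r// nnegrE (le_trans _ (fC x)).
  by move=> x /f0 ->; rewrite normr0 expr0n.
apply: le_lt_trans; rewrite le_eqVlt; apply/orP; left; apply/eqP.
apply: eq_integral => x _ /=.
by rewrite powR_mulrn// normrX normr_id.
Qed.

Definition bumpH1 (R : realType) n (L c : R) (L0 : 0 <= L) : H1 R n :=
  @MkH1 R n (bump L c) (fun i => dbump L c i)
    (Lfun2_bounded_box_supp (@measurable_bump R n L c)
       (bounded_box_supp_bump n c L0))
    (fun i => Lfun2_bounded_box_supp (@measurable_dbump R n L c i)
       (bounded_box_supp_dbump c L0 i))
    (fun i => weak_partial_bump c L0 i).

Lemma integral_box (R : realType) n (a : R) : 0 <= a ->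
  (lebesgue_rV R n).-integrable setT (EFin \o \1_(@box R n a)) /\
  (\int[lebesgue_rV R n]_x (\1_(@box R n a) x)%:E = ((2 * a) ^+ n)%:E)%E.
Proof.
move=> a0; split; last first.
  rewrite integral_indic//; last exact: measurable_box.
  by rewrite setIT lebesgue_rV_cube.
apply: integrable_bounded_box_supp.
  by apply: measurable_indic; exact: measurable_box.
exists a, 1; split => //.
  by move=> x; rewrite indicE; case: (_ \in _); rewrite ?normr1 ?normr0.
by move=> x xa; rewrite indicE memNset.
Qed.

(** The bound is the integral of [C] on the layer between the two cubes and of [- G g c] on the
    inner one, so comparing integrands pointwise suffices. [C] is chosen before [L]. *)
Lemma J_bump (R : realType) n (g : R -> R) (c : R) : continuous g ->
  exists2 C, 0 <= C & forall L (L0 : 0 <= L),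
    (J g (bumpH1 n c L0) <=
      (C * (2 * (L + 1)) ^+ n - (C + G g c) * (2 * L) ^+ n)%:E)%E.
Proof.
move=> cg; have c0 := normr_ge0 c.
have tG := tame_G c0 cg; have tP := tame_Gplus c0 cg.
have tM : tame `|c| (Gminus g) by exact: tameB.
have M0 : Gminus g 0 = 0 by rewrite /Gminus Gplus0 G0 subr0.
have [K GK] := tG.2.
have K0 : 0 <= K by exact: le_trans (normr_ge0 _) (GK c _).
(* The first term is half of [n * (4 * |c|) ^+ 2], the bound on the squared gradient; [K] bounds |G|
   on the range of the bump. *)
exists (8 * n%:R * c ^+ 2 + K).
  by rewrite addr_ge0// mulr_ge0// ?sqr_ge0// mulr_ge0.
set C := _ + K => L L0; set mu := lebesgue_rV R n.
have C0 : 0 <= C by rewrite addr_ge0// mulr_ge0// ?sqr_ge0// mulr_ge0.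
have bc := @bump_le R n L c.
have mb := @measurable_bump R n L c; have bb := bounded_box_supp_bump n c L0.
have [mP bP] := tame_comp tP (Gplus0 g) bc mb bb.
have [mM bM] := tame_comp tM M0 bc mb bb.
pose S (x : 'rV[R]_n) := \sum_(i < n) dbump L c i x ^+ 2.
have SC x : S x <= 16 * n%:R * c ^+ 2.
  rewrite /S (le_trans (y := \sum_(i < n) 16 * c ^+ 2))//.
    apply: ler_sum => i _; rewrite -real_normK ?num_real//.
    rewrite -[c ^+ 2]real_normK ?num_real// (_ : 16 = 4 ^+ 2); last by ring.
    by rewrite -exprMn lerXn2r// ?nnegrE ?mulr_ge0// dbump_le.
  rewrite sumr_const card_ord -mulr_natl le_eqVlt.
  by apply/orP; left; apply/eqP; ring.
have S0 x : 0 <= S x by apply: sumr_ge0 => i _; exact: sqr_ge0.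
have mS : measurable_fun setT S.
  apply: measurable_sum => i; apply: measurable_funX.
  exact: measurable_dbump.
have bS : bounded_box_supp S.
  exists (L + 1), (16 * n%:R * c ^+ 2); split; first exact: addr_ge0.
    by move=> x; rewrite ger0_norm.
  by move=> x xL; rewrite /S big1// => i _; rewrite dbump0// expr0n.
have iS := integrable_bounded_box_supp mS bS.
have iP := integrable_bounded_box_supp mP bP.
have iM := integrable_bounded_box_supp mM bM.
have L10 : 0 <= L + 1 by exact: addr_ge0.
have [i1 E1] := integral_box n L10.
have [i2 E2] := integral_box n L0.
have iS2 := integrableZl measurableT 2^-1 iS.
have iPM := integrableB measurableT iP iM.
have iH1 := integrableZl measurableT C i1.
have iH2 := integrableZl measurableT (C + G g c) i2.
rewrite /J /intG.
rewrite (_ : \int[_]_x (\sum_(i < n) _)%:E = \int[mu]_x (S x)%:E)%E//.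
(* Integrability of each piece allows the extended-real differences in [J] to be merged into one
   integral. *)
rewrite -(integralZl measurableT iS) -(integralB measurableT iP iM).
rewrite -(integralB measurableT iS2 iPM).
(* The cube volumes on the right become integrals of indicators. *)
rewrite EFinB !EFinM -E1 -E2.
rewrite -(integralZl measurableT i1) -(integralZl measurableT i2).
rewrite -(integralB measurableT iH1 iH2).
(* Both integrands equal - G g c on [box L]; off it, [C] dominates half the
   squared gradient plus |G|. *)
apply: le_integral => //; [exact: integrableB|exact: integrableB|].
move=> x _; rewrite /= -!EFinM -!EFinB lee_fin.
have -> : Gplus g (bump L c x) - Gminus g (bump L c x) = G g (bump L c x).
  by rewrite /Gminus opprB addrC subrK.
have boxS : box L x -> box (L + 1) x.
  by move=> h i; apply: le_trans (h i) _; rewrite lerDl.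
rewrite !indicE.
have [xL|xL] := pselect (box L x).
  rewrite !mem_set ?bump_in//; last exact: boxS.
  rewrite (_ : S x = 0); last first.
    by rewrite /S big1// => i _; rewrite dbump_in// expr0n.
  by rewrite !mulr1 mulr0; lra.
rewrite (memNset xL) mulr0 subr0.
have [xL1|xL1] := pselect (box (L + 1) x).
  rewrite mem_set// mulr1.
  have := GK _ (bc x); rewrite ler_norml => /andP[? _].
  by have := SC x; rewrite /C; lra.
rewrite memNset// mulr0 bump0// G0 (_ : S x = 0) ?mulr0 ?subr0//.
by rewrite /S big1// => i _; rewrite dbump0// expr0n.
Qed.

(** * Growth of cube volumes and the conclusion *)

(** A reverse Bernoulli inequality. With b = 3^n, the inductive step expands (1 + t)(1 + b t) and
    bounds both t and b t^2 by b t. *)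
Lemma exprD1_le (R : realFieldType) n (t : R) : 0 <= t <= 1 ->
  (1 + t) ^+ n <= 1 + 3 ^+ n * t.
Proof.
move=> /andP[t0 t1]; elim: n => [|n IH]; first by rewrite !expr0; lra.
have h3 : 1 <= 3 ^+ n :> R by apply: exprn_ege1; lra.
rewrite !exprS; set a := (1 + t) ^+ n in IH *; set b := 3 ^+ n in h3 IH *.
apply: (@le_trans _ _ ((1 + t) * (1 + b * t))).
  by rewrite ler_pM2l//; lra.
have : b * t * t <= b * t by rewrite ler_piMr// mulr_ge0//; lra.
have : t <= b * t by rewrite ler_peMl.
by lra.
Qed.

(* For L >= 2 * C * 3 ^+ n / d, exprD1_le bounds the left-hand side by
   - (d / 2) * (2 * L) ^+ n <= - d * L. *)
Lemma cube_growth (R : realFieldType) n (C d A : R) : (0 < n)%N ->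
  0 <= C -> 0 < d -> exists2 L, 0 <= L &
  C * (2 * (L + 1)) ^+ n - (C + d) * (2 * L) ^+ n <= A.
Proof.
(* The summand 1 ensures [L^-1 <= 1], as [exprD1_le] requires; the summand [|A| / d] gives
   [- d * L <= A]. *)
move=> n0 C0 d0; pose L := 1 + 2 * C * 3 ^+ n / d + `|A| / d.
have e3 : 0 <= 3 ^+ n :> R by exact: exprn_ge0.
have h1 : 0 <= 2 * C * 3 ^+ n / d.
  by apply: divr_ge0; [apply: mulr_ge0 => //; exact: mulr_ge0|exact: ltW].
have h2 : 0 <= `|A| / d by apply: divr_ge0 => //; exact: ltW.
have L1 : 1 <= L by rewrite /L; lra.
have L0 : 0 < L by lra.
exists L; first exact: ltW.
have dL : 2 * C * 3 ^+ n + `|A| <= d * L.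
  have -> : d * L = d + 2 * C * 3 ^+ n + `|A|.
    by rewrite /L; field; exact: lt0r_neq0.
  by lra.
have E : (2 * (L + 1)) ^+ n = (2 * L) ^+ n * (1 + L^-1) ^+ n.
  by rewrite -exprMn; congr (_ ^+ n); field; exact: lt0r_neq0.
have iL : 0 <= L^-1 <= 1 by rewrite invr_ge0 ltW//= invf_le1.
have B := exprD1_le n iL.
have P : 2 * L <= (2 * L) ^+ n by apply: ler_eXnr => //; lra.
have CB : C * (1 + L^-1) ^+ n <= C + d / 2.
  apply: (le_trans (ler_wpM2l C0 B)); rewrite mulrDr mulr1 lerD2l mulrA.
  rewrite ler_pdivrMr//; have := normr_ge0 A; lra.
rewrite E; set X := (2 * L) ^+ n in P *.
have X0 : 0 <= X by lra.
have : X * (C * (1 + L^-1) ^+ n) <= X * (C + d / 2) by rewrite ler_wpM2l.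
have : d / 2 * (2 * L) <= d / 2 * X by rewrite ler_wpM2l//; lra.
have CC : 0 <= C * 3 ^+ n by exact: mulr_ge0.
by have := ler_norm (- A); rewrite normrN; lra.
Qed.

Theorem proposition1p4 (R : realType) (N : nat) (g : R -> R)
  (hN : (2 <= N)%N)
  (ha : continuous g /\ g 0 = 0)
  (hb : Gplus g s / `|s| ^+ 2 @[s --> (0 : R)^'] --> (0 : R) /\
        (limf_esup (fun s : R => (gplus g s / s)%:E) (0%R : R)^' < +oo)%E)
  (hc3 : (3 <= N)%N ->
    (limf_esup (fun s : R =>
       (`|g s| / `|s| `^ (critical_exponent N - 1))%:E) abs_pinfty < +oo)%E)
  (hc2 : N = 2%N -> forall alpha : R, 4 * pi < alpha ->
    g s / expR (alpha * s ^+ 2) @[s --> abs_pinfty] --> (0 : R))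
  (hd : Gplus g s / `|s| `^ (2 + 4 / N%:R) @[s --> abs_pinfty] --> (0 : R))
  (he : exists xi0 : R, xi0 != 0 /\ 0 < G g xi0) :
  ereal_inf [set J g u | u in @mass_ball R N rho] @[rho --> +oo] --> -oo%E.
Proof.
case: ha => cg _; case: he => xi0 [_ Gxi0].
have N0 : (0 < N)%N by exact: leq_trans hN.
have [C C0 JC] := J_bump N xi0 cg.
apply/cvgeNyPle => A.
(* [L] is fixed from [A] alone; the same competitor [u] then serves for all large [rho]. *)
have [L L0 LA] := cube_growth A N0 C0 Gxi0.
pose u := bumpH1 N xi0 L0.
have Ju : (J g u <= A%:E)%E by apply: le_trans (JC L L0) _; rewrite lee_fin.
have iu := Lfun2_integrable_sqr (H1_fun_L2 u).
pose m := fine (\int[lebesgue_rV R N]_x (u x ^+ 2)%:E)%E.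
have mE : (\int[lebesgue_rV R N]_x (`|u x| ^+ 2)%:E = m%:E)%E.
  rewrite fineK; last exact: (integrable_fin_num measurableT iu).
  by apply: eq_integral => x _; rewrite real_normK// num_real.
near=> rho; apply: le_trans Ju; apply: ereal_inf_lbound; exists u => //.
rewrite /mass_ball/= mE lee_fin.
(* With [m] the squared L^2 norm of [u], these two bounds give [m <= rho <= rho ^+ 2]. *)
have r1 : 1 <= rho by near: rho; apply: nbhs_pinfty_ge; exact: num_real.
have rm : m <= rho by near: rho; apply: nbhs_pinfty_ge; exact: num_real.
by rewrite (le_trans rm)// expr2 ler_peMl//; lra.
Unshelve. all: end_near. Qed.
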